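(* For every odd integer $k\ge 3$, a U-cycle of 1-inequitable functions from $\{1,\ldots,k\}$ to $\{0,1\}$ exists. For every even integer $k\ge 4$, a U-cycle of equitable functions from $\{1,\ldots,k\}$ to $\{0,1\}$ does not exist.
   Context: A function $f:\{1,\ldots,k\}\to A$ is identified with the $k$-letter word $f(1)f(2)\cdots f(k)$ over the alphabet $A$. For a set $S$ of $k$-letter words over a finite alphabet $A$, a U-cycle (universal cycle) of $S$ is a cyclic sequence $x_0,x_1,\ldots,x_{N-1}$ of letters of $A$, of length $N\ge 1$ and with indices read modulo $N$, such that the $N$ words $x_i x_{i+1}\cdots x_{i+k-1}$ ($0\le i\le N-1$) all belong to $S$ and each word of $S$ occurs among them exactly once; in particular $N=|S|$. A binary word of even length $k\ge 4$ is equitable if it consists of $k/2$ zeros and $k/2$ ones. A binary word of odd length $k\ge 3$ is 1-inequitable if it consists of $\lfloor k/2\rfloor$ zeros and $\lceil k/2\rceil$ ones, or of $\lceil k/2\rceil$ zeros and $\lfloor k/2\rfloor$ ones. A U-cycle of 1-inequitable (respectively equitable) functions is a U-cycle of the set $S$ of all 1-inequitable (respectively all equitable) binary words of length $k$. *)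

(* Defs.v *)
From mathcomp Require Import all_boot zmodp.

Set Implicit Arguments.
Unset Strict Implicit.
Unset Printing Implicit Defensive.

(* A k-letter word f(1)...f(k) is a finite function on 'I_k, positions being
   numbered from 0. *)
Definition word (A : finType) (k : nat) : finType := {ffun 'I_k -> A}.

(* A cyclic sequence of length N >= 1 is a function on 'I_n.+1 with N = n.+1;
   inZp : nat -> 'I_n.+1 is reduction modulo n.+1. The window may wrap around
   the sequence several times when N < k. *)
Definition window (A : finType) (k n : nat) (x : {ffun 'I_n.+1 -> A})
    (i : 'I_n.+1) : word A k :=
  [ffun j : 'I_k => x (inZp (i + j))].

Definition is_ucycle (A : finType) (k : nat) (S : {set word A k})
    (n : nat) (x : {ffun 'I_n.+1 -> A}) : Prop :=
  (forall i : 'I_n.+1, window k x i \in S) /\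
  (forall w : word A k, w \in S -> exists! i : 'I_n.+1, window k x i = w).

Definition has_ucycle (A : finType) (k : nat) (S : {set word A k}) : Prop :=
  exists (n : nat) (x : {ffun 'I_n.+1 -> A}), is_ucycle S x.

Definition occurrences (A : finType) (k : nat) (a : A) (w : word A k) : nat :=
  #|[set i : 'I_k | w i == a]|.

(* Binary letters are booleans: 0 is false and 1 is true. *)
Definition zeros (k : nat) (w : word bool k) : nat := occurrences false w.
Definition ones (k : nat) (w : word bool k) : nat := occurrences true w.

(* Meant for even k. *)
Definition equitable_words (k : nat) : {set word bool k} :=
  [set w : word bool k | (zeros w == k./2) && (ones w == k./2)].

(* Meant for odd k; k./2 and uphalf k are the floor and ceiling of k/2. *)
Definition one_inequitable_words (k : nat) : {set word bool k} :=
  [set w : word bool k |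
     ((zeros w == k./2) && (ones w == uphalf k)) ||
     ((zeros w == uphalf k) && (ones w == k./2))].

(* Main.v *)
Require Import Defs.
From mathcomp Require Import all_boot fingroup perm zmodp.

(** The existence half is an instance of cycle joining.  Say that a permutation
    of words is a shift when it drops the first letter of every word and appends
    some letter at the end; the first letters of the words met along an orbit of
    a shift then spell a cyclic sequence whose windows are exactly these words,
    each occurring once ([has_ucycle_porbit]).  So a set S of words has a U-cycle
    as soon as some shift preserves S and has S as an orbit.

    If S is closed under cyclic rotation, then rotation is a shift preserving S.
    Among the shifts preserving S, take one with the fewest orbits.  Two words
    of S that differ at most in their first letter lie in the same orbit, for
    otherwise exchanging their images would give a shift preserving S with one
    orbit fewer ([minimal_join]).  It follows that a word and its rotation share
    their orbit ([porbit_rotate]), and hence, rotating an arbitrary position to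
    the front, that any two words of S differing in a single letter do
    ([porbit_agree_off]).  Thus S has a U-cycle whenever it is closed under
    rotation and connected under changes of a single letter
    ([has_ucycle_connected]).  The 1-inequitable words are so connected: a word
    other than the target always has a letter that can be corrected without
    leaving the two middle levels of the Boolean lattice
    ([one_inequitable_connected]).

    For the other half, consecutive windows of a U-cycle of equitable words have
    the same number of ones, so the letter entering is the letter leaving and
    the sequence has period k ([constant_ones_period]).  As 0101...01 is one of
    the windows and k is even, the whole sequence alternates
    ([alternating_window]), whereas the equitable word 0...01...1, which is also
    a window, starts with two equal letters. *)

Set Implicit Arguments.
Unset Strict Implicit.
Unset Printing Implicit Defensive.

(** * Words and rotation *)

Section Words.

Variables (A : finType) (k : nat).
Implicit Types (v w : word A k) (S : {set word A k}).

Definition rotate w : word A k := [ffun j => w (ordS j)].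

Definition agree_off (i : 'I_k) v w : bool :=
  [forall j, (j != i) ==> (v j == w j)].

Definition one_letter_change S : rel (word A k) :=
  [rel v w | [&& v \in S, w \in S & [exists i, agree_off i v w]]].

Lemma agree_offP i v w :
  reflect (forall j, j != i -> v j = w j) (agree_off i v w).
Proof.
apply: (iffP forallP) => [vw j ji | vw j]; last by apply/implyP=> /vw ->.
by have := vw j; rewrite ji /= => /eqP.
Qed.

Lemma rotate_inj : injective rotate.
Proof.
move=> v w /ffunP vw; apply/ffunP=> j.
by have := vw (ord_pred j); rewrite !ffunE ord_predK.
Qed.

Lemma occurrences_rotate a w : occurrences a (rotate w) = occurrences a w.
Proof.
rewrite /occurrences -[RHS](card_preimset _ (@ordS_inj k)); congr #|pred_of_set _|.
by apply/setP=> j; rewrite !inE ffunE.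
Qed.

End Words.

(** * Shifts *)

Section Shifts.

Variables (A : finType) (k : nat) (S : {set word A k.+1}).
Implicit Types (v w : word A k.+1) (s : {perm word A k.+1}).

Definition is_shift s : bool :=
  [forall w, [forall j : 'I_k.+1, (j < k) ==> (s w j == w (ordS j))]].

Definition S_shift s : bool := is_shift s && [forall w in S, s w \in S].

Lemma is_shiftP s :
  reflect (forall w (j : 'I_k.+1), j < k -> s w j = w (ordS j)) (is_shift s).
Proof.
apply: (iffP forallP) => [sh w j jk | sh w].
  by have /forallP/(_ j) := sh w; rewrite jk /= => /eqP.
by apply/forallP=> j; apply/implyP=> jk; rewrite sh.
Qed.

Lemma iter_shift s d w (i j : 'I_k.+1) :
  is_shift s -> j = i + d :> nat -> iter d s w i = w j.
Proof.
move=> /is_shiftP sh; elim: d w j => [|d IHd] w j ji.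
  by congr (w _); apply/val_inj; rewrite /= ji addn0.
have dk : i + d < k by rewrite -ltnS -addnS -ji.
rewrite iterSr (IHd _ (Ordinal (leqW dk))) // sh //; congr (w _).
by apply/val_inj; rewrite /= modn_small // ji addnS.
Qed.

Lemma iter_modn (T : Type) (f : T -> T) x m N :
  iter N f x = x -> iter (m %% N) f x = iter m f x.
Proof.
by move=> fx; rewrite [in RHS](divn_eq m N) addnC iterD iterM (iter_fix (m %/ N) fx).
Qed.

(** The i-th letter is the first letter of the i-th iterate; after j more steps
    of a shift the j-th letter of a word has become its first letter, so the
    i-th window is the i-th iterate itself, whether or not it wraps around. *)
Lemma has_ucycle_porbit s w0 : is_shift s -> has_ucycle (porbit s w0).
Proof.
move=> sh; case N_eq: #|porbit s w0| => [|n].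
  by have := porbit_id s w0; rewrite (card0_eq N_eq).
have period : iter n.+1 s w0 = w0 by rewrite -N_eq iter_porbit.
pose x := [ffun i : 'I_n.+1 => iter i s w0 ord0].
have windowE i : window k.+1 x i = iter i s w0.
  apply/ffunP=> j; rewrite !ffunE /= iter_modn // addnC iterD.
  exact: iter_shift.
exists n, x; split=> [i | w]; first by rewrite windowE -permX mem_porbit.
rewrite porbit_traject N_eq => /trajectP[i i_lt ->].
exists (Ordinal i_lt); split=> [|j]; first exact: windowE.
rewrite windowE => /= ij; apply/val_inj/eqP => /=.
have := uniq_traject_porbit s w0; rewrite N_eq => uniq_orbit.
rewrite -(nth_uniq w0 _ _ uniq_orbit) ?size_traject ?ltn_ord //.
by rewrite !nth_traject ?ltn_ord // ij.
Qed.

Lemma S_shift_rotate :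
  (forall w, w \in S -> rotate w \in S) -> S_shift (perm (@rotate_inj A k.+1)).
Proof.
move=> rotS; apply/andP; split.
  by apply/is_shiftP=> w j _; rewrite permE ffunE.
by apply/forall_inP=> w; rewrite permE; apply: rotS.
Qed.

(** Letter 0 is the one a shift forgets, so precomposing with the exchange of
    two words differing only there leaves the shifting condition intact. *)
Lemma S_shift_tperm s v w : S_shift s -> v \in S -> w \in S ->
  agree_off ord0 v w -> S_shift (tperm v w * s)%g.
Proof.
move=> /andP[/is_shiftP sh /forall_inP stabS] vS wS /agree_offP vw.
apply/andP; split; last first.
  by apply/forall_inP=> u uS; rewrite permM; apply: stabS; case: tpermP.
apply/is_shiftP=> u j jk; rewrite permM sh //.
have nz : ordS j != ord0.
  by apply/eqP=> /(congr1 val) /=; rewrite modn_small.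
by case: tpermP => // ->; rewrite vw.
Qed.

Section Minimal.

Variable s : {perm word A k.+1}.
Hypothesis sS : S_shift s.
Hypothesis s_min : forall t, S_shift t -> #|porbits s| <= #|porbits t|.

Lemma minimal_join v w : v \in S -> w \in S -> agree_off ord0 v w ->
  porbit s v = porbit s w.
Proof.
move=> vS wS vw; apply/eqP; rewrite eq_porbit_mem; apply: contraT => v_w.
have := s_min (S_shift_tperm sS vS wS vw).
have := porbits_mul_tperm s v w; rewrite v_w.
have -> : v != w by apply: contraNneq v_w => ->; rewrite porbit_id.
by rewrite /= addn2 addn1 => -[<-]; rewrite ltnn.
Qed.

Lemma S_shift_preim w : s w \in S -> w \in S.
Proof.
have /andP[_ /forall_inP stabS] := sS.
have sub : s @: S \subset S by apply/subsetP=> _ /imsetP[u uS ->]; apply: stabS.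
have : s @: S == S by rewrite eqEcard sub (card_imset _ (@perm_inj _ s)) leqnn.
by move/eqP=> {1}<-; rewrite (mem_imset _ _ (@perm_inj _ s)).
Qed.

Hypothesis rotS : forall w, w \in S -> rotate w \in S.

(** The word sent to the rotation of v ends like v, so it differs from v at
    most in the first letter. *)
Lemma porbit_rotate v : v \in S -> porbit s (rotate v) = porbit s v.
Proof.
move=> vS; pose y := (s^-1)%g (rotate v).
have sy : s y = rotate v by rewrite /y permKV.
have yS : y \in S by apply: S_shift_preim; rewrite sy rotS.
rewrite -(@minimal_join y v yS vS); last first.
  have /andP[/is_shiftP sh _] := sS.
  apply/agree_offP=> j j0; have j_gt0 : 0 < j by rewrite lt0n.
  have jk : j.-1 < k by rewrite -ltnS prednK.
  have jE : j = ordS (Ordinal (leqW jk)).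
    by apply/val_inj; rewrite /= prednK // modn_small.
  by rewrite [in LHS]jE -sh // sy ffunE -jE.
by rewrite -sy; apply: (porbit_perm s 1).
Qed.

Lemma porbit_agree_off i v w : v \in S -> w \in S -> agree_off i v w ->
  porbit s v = porbit s w.
Proof.
case: i => i; elim: i v w => [|i IHi] v w ik vS wS vw.
  by apply: minimal_join => //; rewrite (_ : ord0 = Ordinal ik) //; apply/val_inj.
rewrite -(porbit_rotate vS) -(porbit_rotate wS).
apply: (IHi _ _ (ltnW ik)); rewrite ?rotS //.
apply/agree_offP=> j ji; rewrite !ffunE; move/agree_offP: vw; apply.
apply: contra ji => /eqP ji; apply/eqP/(@ordS_inj k.+1); rewrite ji.
by apply/val_inj; rewrite /= modn_small.
Qed.

Lemma porbit_connect v w :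
  connect (one_letter_change S) v w -> porbit s v = porbit s w.
Proof.
case/connectP=> p; elim: p v => [|u p IHp] v /=; first by move=> _ ->.
case/andP=> /and3P[vS uS /existsP[i vu]] path_p w_last.
by rewrite (porbit_agree_off vS uS vu) (IHp u).
Qed.

End Minimal.

Theorem has_ucycle_connected w0 :
    w0 \in S -> (forall w, w \in S -> rotate w \in S) ->
    {in S, forall w, connect (one_letter_change S) w0 w} ->
  has_ucycle S.
Proof.
move=> w0S rotS conn.
case: (arg_minnP (fun s => #|porbits s|) (S_shift_rotate rotS)) => s sS s_min.
have /andP[sh /forall_inP stabS] := sS.
suff -> : S = porbit s w0 by apply: has_ucycle_porbit.
apply/setP=> w; apply/idP/idP => [wS | /porbitP[i ->]].
  by rewrite (porbit_connect sS s_min rotS (conn w wS)) porbit_id.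
by rewrite permX; elim: i => //= i; apply: stabS.
Qed.

End Shifts.

(** * Numbers of ones in binary words *)

Section Binary.

Variable k : nat.
Implicit Types (u v w : word bool k) (i : 'I_k).

Lemma zeros_addn_ones w : zeros w + ones w = k.
Proof.
rewrite /zeros /ones /occurrences -[in RHS](card_ord k).
rewrite -(cardC [set i | w i == false]); congr (_ + _).
by apply: eq_card => i; rewrite !inE; case: (w i).
Qed.

Lemma ones_sum w : ones w = \sum_(j < k) w j.
Proof.
rewrite /ones /occurrences -sum1dep_card big_mkcond /=.
by apply: eq_bigr => j _; case: (w j).
Qed.

Lemma one_inequitable_ones w : odd k ->
  (w \in one_inequitable_words k) = (ones w == k./2) || (ones w == k./2.+1).
Proof.
move=> k_odd; rewrite inE uphalf_half k_odd add1n.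
have zo : zeros w + ones w = k./2 + k./2.+1.
  by rewrite zeros_addn_ones addnS addnn -[LHS]odd_double_half k_odd.
apply/orP/orP => [[|]/andP[_ ->]|[|]/eqP w1]; rewrite ?orbT; first by right.
- by left.
- by right; rewrite w1 eqxx andbT -(eqn_add2r (ones w)) zo w1 addSnnS.
- by left; rewrite w1 eqxx andbT -(eqn_add2r (ones w)) zo w1.
Qed.

Lemma equitable_ones w : ~~ odd k ->
  (w \in equitable_words k) = (ones w == k./2).
Proof.
move=> k_even; rewrite inE; apply/andP/idP => [[]//|/eqP w1].
rewrite w1 eqxx -(eqn_add2r (ones w)) zeros_addn_ones w1 addnn.
by rewrite -[k in k == _]odd_double_half (negPf k_even).
Qed.

Lemma ones_leq_neq v w :
  v != w -> ones v <= ones w -> exists i, w i && ~~ v i.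
Proof.
move=> v_w le_vw; apply/existsP; apply: contraNT v_w => /existsPn wv.
have /eqP/setP supp_eq : [set i | w i == true] == [set i | v i == true].
  rewrite eqEcard le_vw andbT; apply/subsetP=> i; rewrite !inE.
  by have := wv i; case: (v i); case: (w i).
apply/eqP/ffunP=> i; have := supp_eq i; rewrite !inE.
by case: (v i); case: (w i).
Qed.

Definition flip w i : word bool k := [ffun j => w j (+) (j == i)].

Lemma ones_flip w i : ones (flip w i) + w i = ones w + ~~ w i.
Proof.
rewrite !ones_sum (bigD1 i) //= [in RHS](bigD1 i) //= ffunE eqxx addbT.
under eq_bigr => j /negPf ji do rewrite ffunE ji addbF.
by rewrite addnAC [~~ _ + _]addnC addnAC.
Qed.

End Binary.

(** * Connectivity of the 1-inequitable words *)

(** Below the middle (respectively above it), the source has at most (at least)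
    as many ones as the target, so some zero (one) of it is wrong; correcting
    this letter leads to the other of the two middle levels. *)
Lemma one_inequitable_connected k : odd k ->
  {in one_inequitable_words k &, forall v w,
     connect (one_letter_change (one_inequitable_words k)) v w}.
Proof.
move=> k_odd v w vS wS.
have [n] := ubnP #|[set i | v i != w i]|; elim: n v vS => // n IHn v vS dist_v.
have [->|v_w] := eqVneq v w; first exact: connect0.
have [i vi_wi uS] : exists2 i, v i != w i & flip v i \in one_inequitable_words k.
  move: (vS) (wS); rewrite !one_inequitable_ones //.
  case/orP=> /eqP v1 w1.
    have [|i /andP[wi vi]] := ones_leq_neq v_w.
      by rewrite v1; case/orP: w1 => /eqP->.
    exists i; first by rewrite wi (negPf vi).
    have := ones_flip v i; rewrite v1 vi (negPf vi) addn0 addn1 => u1.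
    by rewrite one_inequitable_ones // u1 eqxx orbT.
  rewrite eq_sym in v_w; have [|i /andP[vi wi]] := ones_leq_neq v_w.
    by rewrite v1; case/orP: w1 => /eqP->.
  exists i; first by rewrite vi (negPf wi).
  have := ones_flip v i; rewrite v1 vi addn0 addn1 => -[u1].
  by rewrite one_inequitable_ones // u1 eqxx.
apply: (@connect_trans _ _ (flip v i)).
  apply/connect1/and3P; split=> //; apply/existsP; exists i.
  by apply/agree_offP=> j /negPf ji; rewrite ffunE ji addbF.
apply: IHn => //; rewrite ltnS in dist_v; apply: leq_trans dist_v.
rewrite [in leqRHS](cardsD1 i) inE vi_wi add1n ltnS subset_leq_card //.
apply/subsetP=> j; rewrite !inE ffunE; case: (eqVneq j i) => [->|_]; rewrite ?addbF //.
by move: vi_wi; case: (v i); case: (w i).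
Qed.

(** * Cyclic sequences all of whose windows are equitable *)

Section Periodic.

Variables (k n : nat) (x : {ffun 'I_n.+1 -> bool}).

Lemma window_inZp i (j : 'I_k) : window k x (inZp i) j = x (inZp (i + j)).
Proof. by rewrite ffunE; congr (x _); apply/val_inj; rewrite /= modnDml. Qed.

(** Two consecutive windows have all letters in common but the first letter of
    one and the last letter of the other. *)
Lemma constant_ones_period m i :
  (forall i, ones (window k x i) = m) -> x (inZp (i + k)) = x (inZp i).
Proof.
move=> onesE; have := onesE (inZp i); rewrite -(onesE (inZp i.+1)) !ones_sum.
under eq_bigr do rewrite window_inZp.
under [in RHS]eq_bigr do rewrite window_inZp.
case: k => [|k']; first by rewrite addn0.
rewrite big_ord_recl big_ord_recr /= addnC addn0 addSnnS.
under eq_bigr do rewrite /bump /= add1n -addSnnS.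
by move/addnI; case: (x _); case: (x _).
Qed.

Lemma alternating_window a i : ~~ odd k -> 0 < k ->
    (forall i, x (inZp (i + k)) = x (inZp i)) ->
    (forall j, window k x a j = odd j) ->
  x (inZp i.+1) = ~~ x (inZp i).
Proof.
move=> k_even k_gt0 period alt.
(* As k is even, the parity of a position survives reduction modulo k. *)
have xE t : x (inZp (a + t)) = odd t.
  rewrite (divn_eq t k) oddD oddM (negPf k_even) andbF /=.
  elim: (t %/ k) => [|q IHq]; last by rewrite mulSn -addnA addnCA addnC period.
  by have := alt (Ordinal (ltn_pmod t k_gt0)); rewrite ffunE.
have {}xE t : x (inZp t) = odd (n.+1 - a + t).
  rewrite -xE addnA subnKC ?(ltnW (ltn_ord a)) //.
  by congr (x _); apply/val_inj; rewrite /= modnDl.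
by rewrite !xE addnS.
Qed.

End Periodic.

Lemma sum_odd k : \sum_(j < k) odd j = k./2.
Proof.
by elim: k => [|k IHk]; rewrite ?big_ord0 // big_ord_recr IHk /= uphalf_half addnC.
Qed.

Lemma sum_leq m k : \sum_(j < k) (m <= j) = k - m.
Proof.
elim: k => [|k IHk]; first by rewrite big_ord0.
rewrite big_ord_recr IHk /=; case: leqP => [mk | km]; first by rewrite subSn ?addn1.
by rewrite addn0 (eqP (ltnW km)) (eqP km).
Qed.

Theorem no_equitable_ucycle k :
  4 <= k -> ~~ odd k -> ~ has_ucycle (equitable_words k).
Proof.
move=> k_ge4 k_even [n [x [windowS S_window]]].
have onesE i : ones (window k x i) = k./2.
  by apply/eqP; rewrite -equitable_ones.
have period i := constant_ones_period i onesE.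
have k_gt0 : 0 < k by apply: leq_trans k_ge4.
have k_gt1 : 1 < k by apply: leq_trans k_ge4.
have half_gt1 : 1 < k./2 by apply: (half_leq k_ge4).
have [|a [alt _]] := S_window [ffun j : 'I_k => odd j].
  by rewrite equitable_ones // ones_sum -sum_odd; under eq_bigr do rewrite ffunE.
have [|b [step _]] := S_window [ffun j : 'I_k => k./2 <= j].
  rewrite equitable_ones // ones_sum; under eq_bigr do rewrite ffunE.
  by rewrite sum_leq -[X in X - _]odd_double_half (negPf k_even) add0n -addnn addnK.
have altE j : window k x a j = odd j by rewrite alt ffunE.
have := alternating_window b k_even k_gt0 period altE.
move/ffunP: step => step.
have := step (Ordinal k_gt0); have := step (Ordinal k_gt1).
rewrite !ffunE /= addn0 addn1 leqn0 leqNgt half_gt1 => -> ->.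
by case: (k./2) half_gt1.
Qed.

Theorem theorem5 :
  (forall k : nat, 3 <= k -> odd k -> has_ucycle (one_inequitable_words k)) /\
  (forall k : nat, 4 <= k -> ~~ odd k -> ~ has_ucycle (equitable_words k)).
Proof.
split=> [k _ k_odd|]; last exact: no_equitable_ucycle.
case: k k_odd => // k k_odd; pose w0 : word bool k.+1 := [ffun j : 'I_k.+1 => odd j].
have w0S : w0 \in one_inequitable_words k.+1.
  rewrite one_inequitable_ones // ones_sum -sum_odd.
  by under eq_bigr do rewrite ffunE; rewrite eqxx.
apply: (has_ucycle_connected w0S) => [w | w wS].
  by rewrite !inE /zeros /ones !occurrences_rotate.
exact: one_inequitable_connected.
Qed.
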